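(* If $g_i(p)=1-(1-p)^{d_i}$, $i=1,2$, for $1<d_1<d_2$, then deductible insurance is optimal.
   Context: Let $(\Omega,\mathcal{F},\mathbb{P})$ be a probability space. For an almost surely finite random variable $Y$ let $S_Y(t)=\mathbb{P}(Y>t)$. A concave distortion is a non-decreasing concave function $g:[0,1]\to[0,1]$ with $g(0)=0$, $g(1)=1$; its distortion risk measure is $H_g(Y)=\int_{-\infty}^0(g[S_Y(t)]-1)\,dt+\int_0^\infty g[S_Y(t)]\,dt$. An individual (agent 2) faces a random loss $X\ge 0$ and may buy insurance from an insurer (agent 1, with initial loss $0$). The distortions of insurer and buyer are $g_1$ and $g_2$; $H_{g_2}(X)$ is assumed finite. There are constants $0<b_1<\theta$. The preference functionals (to be minimized) are $$V_1(Y)=(1+b_1)H_{g_1}(Y)-(1+\theta)\,\mathbb{E}Y,\qquad V_2(Y)=H_{g_2}(Y)-(1+\theta)\,\mathbb{E}Y.$$ An allocation is a pair $(Y_1,Y_2)$ with $Y_1+Y_2=X$ and $V_1(Y_1),V_2(Y_2)$ finite. It is Pareto optimal if any allocation $(Z_1,Z_2)$ with $V_i(Z_i)\le V_i(Y_i)$, $i=1,2$, satisfies $V_i(Z_i)=V_i(Y_i)$, $i=1,2$. ''Deductible insurance is optimal'' means: there is a deductible $D\in[0,\infty]$ such that, with $f^*(x)=(x-D)_+$ (and $f^*\equiv 0$ when $D=\infty$), the allocation $(f^*(X),X-f^*(X))$ is Pareto optimal. *)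

(* Defs.v *)
From HB Require Import structures.
From mathcomp Require Import all_boot all_order all_algebra.
From mathcomp Require Import all_classical all_reals all_analysis.
From mathcomp Require Import measurable_realfun.

Set Implicit Arguments.
Unset Strict Implicit.
Unset Printing Implicit Defensive.

Import Order.TTheory GRing.Theory Num.Theory.
Import numFieldNormedType.Exports.

Local Open Scope classical_set_scope.
Local Open Scope ring_scope.

Section distortion.
Context {d : measure_display} {T : measurableType d} {R : realType}.
Variable P : probability T R.

Definition survival (Y : {RV P >-> R}) (t : R) : R := fine (ccdf Y t).

(* [g] is only evaluated at probabilities, so only its values on [0, 1]
   matter. If both integrals are infinite the sum is [-oo], not finite. *)
Definition distortion_risk (g : R -> R) (Y : {RV P >-> R}) : \bar R :=
  (\int[lebesgue_measure]_(t in `]-oo, 0%R]) (g (survival Y t) - 1)%:E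
   + \int[lebesgue_measure]_(t in `[0%R, +oo[) (g (survival Y t))%:E)%E.

(* A sum in [\bar R] is finite only if both summands are, so finiteness of
   [insurer_pref] or [buyer_pref] at [Y] entails that of the risk measure and
   of ['E_P[Y]]; indeterminate forms [oo - oo] are not finite. *)
Definition insurer_pref (b1 theta : R) (g1 : R -> R) (Y : {RV P >-> R})
    : \bar R :=
  ((1 + b1)%:E * distortion_risk g1 Y - (1 + theta)%:E * 'E_P[Y])%E.

Definition buyer_pref (theta : R) (g2 : R -> R) (Y : {RV P >-> R}) : \bar R :=
  (distortion_risk g2 Y - (1 + theta)%:E * 'E_P[Y])%E.

Definition allocation (V1 V2 : {RV P >-> R} -> \bar R)
    (X Y1 Y2 : {RV P >-> R}) : Prop :=
  [/\ {ae P, forall w, Y1 w + Y2 w = X w},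
      V1 Y1 \is a fin_num & V2 Y2 \is a fin_num].

Definition pareto_optimal (V1 V2 : {RV P >-> R} -> \bar R)
    (X Y1 Y2 : {RV P >-> R}) : Prop :=
  allocation V1 V2 X Y1 Y2 /\
  forall Z1 Z2 : {RV P >-> R}, allocation V1 V2 X Z1 Z2 ->
    (V1 Z1 <= V1 Y1)%E -> (V2 Z2 <= V2 Y2)%E ->
    V1 Z1 = V1 Y1 /\ V2 Z2 = V2 Y2.

End distortion.

(* [x |-> (x - D)_+], and the zero function when [D = +oo]; only used for
   [0 <= D]. *)
Definition deductible {R : realType} (D : \bar R) (x : R) : R :=
  if D is r%:E then Num.max (x - r) 0 else 0.

Lemma measurable_deductible {R : realType} (D : \bar R) :
  measurable_fun [set: R] (deductible D).
Proof.
by case: D => [r| |]; do ?exact: measurable_cst;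
  apply: measurable_maxr => //; apply: measurable_funB.
Qed.

HB.instance Definition _ {R : realType} (D : \bar R) :=
  isMeasurableFun.Build _ _ _ _ (deductible D) (measurable_deductible D).

Definition deductible_optimal {d : measure_display} {T : measurableType d}
    {R : realType} (P : probability T R) (V1 V2 : {RV P >-> R} -> \bar R)
    (X : {RV P >-> R}) : Prop :=
  exists D : \bar R, (0 <= D)%E /\
    pareto_optimal V1 V2 X (deductible D \o X) (X \- (deductible D \o X)).

Definition dual_power {R : realType} (a p : R) : R := 1 - (1 - p) `^ a.

(* Main.v *)
Require Import Defs.
From HB Require Import structures.
From mathcomp Require Import all_boot all_order all_algebra.
From mathcomp Require Import all_classical all_reals all_analysis.
From mathcomp Require Import measurable_realfun.
From mathcomp Require Import ring lra.
Import Order.TTheory GRing.Theory Num.Theory.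
Import numFieldNormedType.Exports.
Local Open Scope classical_set_scope.
Local Open Scope ring_scope.

(** Give the insurer the weight [theta] and the buyer the weight
    [theta - b1], both positive.  An allocation that minimizes the weighted sum
    of the two preferences is Pareto optimal ([weighted_le_eq]).  On
    allocations of [X] this sum is, up to a positive factor and a constant
    ([weighted_pref]),
    [H_K1 (Z1) + H_K2 (Z2)], where [K1 = g1] and
    [K2 s = k g2 s + (1 - k) s] are both concave distortions of mass 1.

    For the lower bound put [g = min (K1, K2)], which is concave.  Distortion
    risk measures of concave distortions are subadditive
    ([concave_subadditive]), so
    [H_K1 (Z1) + H_K2 (Z2) >= H_g (Z1) + H_g (Z2) >= H_g (X)].
    The right-hand side integrates [min (K1 (S t), K2 (S t))] over [t >= 0],
    where [S] is the survival function of [X]: each infinitesimal layer of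
    the loss goes to the agent who prices it lower.  The bound is attained by
    a deductible if [K1] is the cheaper price exactly for small survival
    probabilities, that is for high layers ([exists_optimal_deductible]).  For
    dual power distortions this single crossing comes from the concavity of
    [v - k v ^ e] with [e >= 1] ([mixed_dual_power_crossing]).

    Subadditivity is built up from the extreme case [g s = min s c], where the
    Choquet integral has the variational form
    [min_x (E max (Y, x) - (1 - c) x)] ([choquet_cap_le], [choquet_capE]), from
    which it is immediate.  The interpolation of a concave distortion at
    equidistant knots is a nonnegative combination of such caps
    ([interp_subadditive]), and the distortion itself is their limit.  All
    distortions here are Lipschitz on [[0, 1]]; this gives domination by the
    integrand of the expectation, and identifies the admissible risks with the
    integrable ones ([pref_fin_num_iff]). *)

Set Implicit Arguments.
Unset Strict Implicit.
Unset Printing Implicit Defensive.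

(** * Survival functions and Choquet integrands *)

Section survival_function.
Context {d : measure_display} {T : measurableType d} {R : realType}.
Variable P : probability T R.
Implicit Types (Y Z : {RV P >-> R}) (t : R).

Lemma survivalE Y t : survival Y t = fine (P [set w | t < Y w]).
Proof.
rewrite /survival /ccdf /distribution /pushforward; congr (fine (P _)).
by apply/seteqP; split => w /=; rewrite in_itv/= andbT.
Qed.

Lemma measurable_exceed Y t : measurable [set w | t < Y w].
Proof.
rewrite (_ : [set _ | _] = Y @^-1` `]t, +oo[); first exact: measurable_funPTI.
by apply/seteqP; split => w /=; rewrite in_itv/= andbT.
Qed.

Lemma EFin_survival Y t : (survival Y t)%:E = ccdf Y t.
Proof. by rewrite fineK// fin_num_measure. Qed.

Lemma survival_ge0 Y t : 0 <= survival Y t.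
Proof. exact: fine_ge0. Qed.

Lemma survival_le1 Y t : survival Y t <= 1.
Proof. by rewrite -lee_fin EFin_survival probability_le1. Qed.

Lemma survival_nonincreasing Y : nonincreasing_fun (survival Y).
Proof.
move=> s t st; rewrite -lee_fin !EFin_survival; exact: ccdf_nonincreasing.
Qed.

Lemma eq_survival Y Z t : (forall w, (t < Y w) = (t < Z w)) ->
  survival Y t = survival Z t.
Proof.
move=> YZ; rewrite !survivalE; congr (fine (P _)).
by apply/seteqP; split => w /=; rewrite YZ.
Qed.

Lemma survival_eq0 Y t : (forall w, Y w <= t) -> survival Y t = 0.
Proof.
move=> Yt; rewrite survivalE (_ : [set _ | _] = set0) ?measure0//.
by apply/seteqP; split => w //=; rewrite ltNge Yt.
Qed.

Lemma survival_eq1 Y t : {ae P, forall w, t < Y w} -> survival Y t = 1.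
Proof.
move=> tY; rewrite survivalE -[[set _ | _]]setCK probability_setC.
  by rewrite measure_negligible ?sube0//; exact/measurableC/measurable_exceed.
exact/measurableC/measurable_exceed.
Qed.

End survival_function.

Section ae_Rintegral.
Context {d : measure_display} {T : measurableType d} {R : realType}.
Variable mu : {measure set T -> \bar R}.
Implicit Types f g : T -> R.

(** Almost everywhere [g - f] equals its absolute value, whose integral is
    nonnegative. *)
Lemma ae_le_Rintegral f g :
  mu.-integrable setT (EFin \o f) -> mu.-integrable setT (EFin \o g) ->
  {ae mu, forall x, f x <= g x} -> \int[mu]_x f x <= \int[mu]_x g x.
Proof.
move=> fi gi fg; rewrite -subr_ge0 -RintegralB//.
have gfi : mu.-integrable setT (EFin \o (fun x => g x - f x)).
  exact: (integrableB _ gi fi).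
have -> : \int[mu]_x (g x - f x) = \int[mu]_x `|g x - f x|.
  congr fine; apply: ae_eq_integral => //.
  - exact: (measurable_int mu gfi).
  - exact: (measurable_int mu (integrable_norm gfi)).
  - by apply: filterS fg => x fgx _; rewrite ger0_norm// subr_ge0.
by apply: Rintegral_ge0.
Qed.

Lemma ae_eq_Rintegral f g :
  mu.-integrable setT (EFin \o f) -> mu.-integrable setT (EFin \o g) ->
  {ae mu, forall x, f x = g x} -> \int[mu]_x f x = \int[mu]_x g x.
Proof.
move=> fi gi fg; apply/eqP; rewrite eq_le !ae_le_Rintegral//;
  by apply: filterS fg => x ->.
Qed.

End ae_Rintegral.

(** The Lipschitz bound is what makes the theory elementary: together with
    [g 0 = 0] it dominates every Choquet integrand by a multiple of the one of
    the expectation, so that integrability of the random variable suffices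
    everywhere.  The total mass [g 1] is left free, because the building blocks
    [s |-> min s c] have mass [c]. *)
Definition lip_distortion {R : realType} (L : R) (g : R -> R) :=
  g 0 = 0 /\
  forall s s', 0 <= s -> s <= s' -> s' <= 1 -> 0 <= g s' - g s <= L * (s' - s).

Lemma lip_distortion_id {R : realType} : lip_distortion 1 (@id R).
Proof. by split => // s s' _ ss' _; rewrite mul1r lexx subr_ge0 ss'. Qed.

Section half_lines.
Context {R : realType}.

Lemma setT_itv0 : [set: R] = `]-oo, 0%R[ `|` `[0%R, +oo[.
Proof.
apply/seteqP; split => x //= _; rewrite !in_itv/= andbT.
by have [|] := ltP x 0; [left|right].
Qed.

Lemma disj_itv0 : [disjoint (`]-oo, 0%R[ : set R) & (`[0%R, +oo[ : set R)].
Proof.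
by apply/disj_setPS => x [] /=; rewrite !in_itv/= andbT => /lt_geF ->.
Qed.

End half_lines.

Section layer.
Context {d : measure_display} {T : measurableType d} {R : realType}.
Variable P : probability T R.
Implicit Types (Y Z : {RV P >-> R}) (g h : R -> R) (L s t : R).

(** The integrand of the distortion risk measure, as a single function on the
    line: monetary identities between risks then become pointwise identities
    between layers. *)
Definition layer g Y t : R :=
  if t < 0 then g (survival Y t) - g 1 else g (survival Y t).

(** The Choquet integral of [Y] with respect to the capacity
    [A |-> g (P A)]. *)
Definition choquet g Y : R := \int[lebesgue_measure]_t layer g Y t.

Definition rv_integrable Y := P.-integrable setT (EFin \o Y).

Lemma eq_layer g h Y : (forall s, 0 <= s <= 1 -> g s = h s) ->
  layer g Y = layer h Y.
Proof.
move=> gh; apply/funext => t; rewrite /layer.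
by rewrite (gh (survival Y t)) ?survival_ge0 ?survival_le1// (gh 1)//
  ler01 lexx.
Qed.

Lemma measurable_comp_survival L g Y : lip_distortion L g ->
  measurable_fun setT (g \o survival Y).
Proof.
move=> [_ gL]; apply: nonincreasing_measurable => // s t st /=.
rewrite -subr_ge0.
have /andP[//] := gL _ _ (survival_ge0 Y t) (survival_nonincreasing Y st)
  (survival_le1 Y s).
Qed.

Lemma measurable_layer L g Y : lip_distortion L g ->
  measurable_fun setT (layer g Y).
Proof.
move=> gL; have mg := measurable_comp_survival Y gL.
apply: measurable_fun_if => //.
- exact: measurable_fun_ltr.
- by apply: measurable_funTS; exact: measurable_funB.
- by apply: measurable_funTS.
Qed.

Lemma normr_layer_le L g Y t : lip_distortion L g ->
  `|layer g Y t| <= L * `|layer id Y t|.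
Proof.
move=> [g0 gL]; rewrite /layer; have S0 := survival_ge0 Y t.
have S1 := survival_le1 Y t; case: ifPn => _.
  rewrite distrC (distrC _ 1).
  have /andP[g_ge0 gle] := gL _ _ S0 S1 (lexx 1).
  by rewrite !ger0_norm// subr_ge0.
have := gL _ _ (lexx 0) S0 S1; rewrite g0 !subr0 => /andP[g_ge0 gle].
by rewrite !ger0_norm.
Qed.

(** The two half-lines carry the expectations of the positive and of the
    negative part, both finite. *)
Lemma integrable_layer_id Y : rv_integrable Y ->
  lebesgue_measure.-integrable setT (EFin \o layer id Y).
Proof.
move=> Yi; apply/integrableP; split.
  by apply/measurable_EFinP; apply: measurable_layer lip_distortion_id.
rewrite setT_itv0.
have m : measurable_fun setT (fun t => `|(EFin \o layer id Y) t|%E).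
  apply: measurableT_comp => //.
  by apply/measurable_EFinP; apply: measurable_layer lip_distortion_id.
rewrite ge0_integral_setU//=; last 2 first.
- exact: measurable_funTS.
- exact: disj_itv0.
pose Yp : {RV P >-> R} := Y^\+; pose Yn : {RV P >-> R} := Y^\-.
have Ypi : ('E_P[Yp] \is a fin_num)%E.
  rewrite unlock; exact/integrable_fin_num/(integrable_funrpos measurableT Yi).
have Yni : ('E_P[(- Yn)%R] \is a fin_num)%E.
  rewrite unlock; apply: integrable_fin_num => //.
  have Yni := integrable_funrneg measurableT Yi.
  have Z := integrableN Yni. apply: eq_integrable Z => //. 
rewrite lte_add_pinfty//.
- apply: le_lt_trans (_ : (- 'E_P[(- Yn)%R] < +oo)%E).
    rewrite (@le0_expectation_cdf _ _ _ P (- Yn)%R); last first.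
      by move=> w; rewrite oppr_le0 funrneg_ge0.
    rewrite oppeK; apply: ge0_le_integral => //=.
    + exact: measurable_funTS.
    + by apply: measurable_funTS; exact: cdf_measurable.
    + move=> t; rewrite in_itv/= => t0; rewrite /layer t0 distrC ger0_norm.
        rewrite EFinB EFin_survival -cdf_1_ccdf; 
        apply: (@le_measure _ _ _ P).
        * rewrite inE; exact: measurable_funPTI.
        * rewrite inE; exact: measurable_funPTI.
        * move=> w/=; rewrite !in_itv/= => Yt.
          rewrite /= lerNl /Yn /funrneg /= le_max lerN2 Yt//.
      by rewrite subr_ge0 survival_le1.
  by rewrite ltey_eq fin_numN Yni.
- apply: le_lt_trans (_ : ('E_P[Yp] < +oo)%E); last by rewrite ltey_eq Ypi.
  rewrite ge0_expectation_ccdf; last by move=> w; exact: funrpos_ge0.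
  apply: ge0_le_integral => //=.
  + exact: measurable_funTS.
  + by apply: measurable_funTS; exact: ccdf_measurable.
  + move=> t; rewrite in_itv/= andbT => t0.
    rewrite /layer ltNge t0/= ger0_norm ?survival_ge0// EFin_survival.
    apply: (@le_measure _ _ _ P).
    * rewrite inE; exact: measurable_funPTI.
    * rewrite inE; exact: measurable_funPTI.
    * move=> w/=; rewrite !in_itv/= !andbT => Yt.
      by rewrite /funrpos lt_max Yt.
Qed.

End layer.

(** * Choquet integrals of integrable risks *)

Section choquet.
Context {d : measure_display} {T : measurableType d} {R : realType}.
Variable P : probability T R.
Implicit Types (Y Z : {RV P >-> R}) (g h : R -> R) (L s t : R).

Notation leb := (@lebesgue_measure R).

Lemma integrable_layer L g Y : lip_distortion L g -> rv_integrable Y ->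
  leb.-integrable setT (EFin \o layer g Y).
Proof.
move=> gL Yi; have Li := integrableZl measurableT L (integrable_layer_id Yi).
apply: le_integrable Li => //.
  by apply/measurable_EFinP; apply: measurable_layer gL.
move=> t _; rewrite lee_fin normrM (le_trans (normr_layer_le _ _ gL))//.
by rewrite ler_wpM2r// ler_norm.
Qed.

Lemma choquet_split L g Y : lip_distortion L g -> rv_integrable Y ->
  ((choquet g Y)%:E =
   \int[leb]_(t in `]-oo, 0%R[) (g (survival Y t) - g 1)%:E +
   \int[leb]_(t in `[0%R, +oo[) (g (survival Y t))%:E)%E.
Proof.
move=> gL Yi; have gi := integrable_layer gL Yi.
rewrite fineK; last exact: integrable_fin_num.
rewrite setT_itv0 integral_setU_EFin//; last 2 first.
- by apply/measurable_funTS; exact: measurable_layer gL.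
- exact: disj_itv0.
by congr (_ + _)%E; apply: eq_integral => t; rewrite inE/= in_itv/= ?andbT;
  rewrite /layer => t0; rewrite ?t0// ltNge t0.
Qed.

(** The point [0], which the two half-lines of the risk measure share, is
    negligible. *)
Lemma distortion_risk_choquet L g Y : lip_distortion L g -> g 1 = 1 ->
  rv_integrable Y -> distortion_risk g Y = (choquet g Y)%:E.
Proof.
move=> gL g1 Yi; rewrite (choquet_split gL Yi) g1 /distortion_risk.
congr (_ + _)%E; rewrite -integral_itv_bndo_bndc//.
apply/measurable_EFinP/measurable_funTS/measurable_funB => //.
exact: measurable_comp_survival gL.
Qed.

Lemma expectation_choquet Y : rv_integrable Y ->
  ('E_P[Y] = (choquet id Y)%:E)%E.
Proof.
move=> Yi; rewrite (choquet_split lip_distortion_id Yi).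
rewrite expectation_cdf_ccdf; last exact/Lfun1_integrable.
rewrite addeC; congr (_ + _)%E; last first.
  by apply: eq_integral => t _; rewrite EFin_survival.
rewrite -integral_ge0N//; apply: eq_integral => t _.
by rewrite cdf_1_ccdf -EFin_survival -EFinB -EFinN opprB.
Qed.

Lemma Rintegral_choquet Y : rv_integrable Y -> \int[P]_w Y w = choquet id Y.
Proof.
by move=> Yi; have := expectation_choquet Yi; rewrite unlock /Rintegral => ->.
Qed.

Lemma le_choquet L L' g h Y Z :
  lip_distortion L g -> lip_distortion L' h ->
  rv_integrable Y -> rv_integrable Z ->
  (forall t, layer g Y t <= layer h Z t) -> choquet g Y <= choquet h Z.
Proof.
move=> gL hL Yi Zi gh; apply: le_Rintegral => //.
- exact: integrable_layer gL Yi.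
- exact: integrable_layer hL Zi.
Qed.

Lemma lip_distortionD L L' g h : lip_distortion L g -> lip_distortion L' h ->
  lip_distortion (L + L') (fun s => g s + h s).
Proof.
move=> [g0 gL] [h0 hL]; split; first by rewrite g0 h0 addr0.
move=> s s' s0 ss' s1; have := gL _ _ s0 ss' s1; have := hL _ _ s0 ss' s1.
by rewrite mulrDl => /andP[? ?] /andP[? ?]; lra.
Qed.

Lemma lip_distortionZ L g a : 0 <= a -> lip_distortion L g ->
  lip_distortion (a * L) (fun s => a * g s).
Proof.
move=> a0 [g0 gL]; split; first by rewrite g0 mulr0.
move=> s s' s0 ss' s1; have /andP[? ?] := gL _ _ s0 ss' s1.
by rewrite -mulrBr -mulrA mulr_ge0//= ler_wpM2l.
Qed.

Lemma choquetD L L' g h Y : lip_distortion L g -> lip_distortion L' h ->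
  rv_integrable Y ->
  choquet (fun s => g s + h s) Y = choquet g Y + choquet h Y.
Proof.
move=> gL hL Yi; rewrite -RintegralD//;
  [|exact: integrable_layer gL Yi|exact: integrable_layer hL Yi].
apply: eq_Rintegral => t _; rewrite /layer; case: ifPn => // _; lra.
Qed.

Lemma choquetZ L g a Y : lip_distortion L g -> rv_integrable Y ->
  choquet (fun s => a * g s) Y = a * choquet g Y.
Proof.
move=> gL Yi; rewrite -RintegralZl//; last exact: integrable_layer gL Yi.
by apply: eq_Rintegral => t _; rewrite /layer; case: ifPn => // _; lra.
Qed.

End choquet.

(** * Tail averages *)

Section tail_average.
Context {d : measure_display} {T : measurableType d} {R : realType}.
Variable P : probability T R.
Implicit Types (Y Z : {RV P >-> R}) (c s t x : R).

(** The extreme concave distortions; for [c <= 1] the Choquet integral of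
    [cap c] is [c] times the tail average (conditional value at risk) of the
    upper [c]-tail. *)
Definition cap c s : R := Num.min s c.

Definition floor_at Y x : T -> R := fun w => Num.max (Y w) x.

Let measurable_floor_at Y x : measurable_fun setT (floor_at Y x).
Proof. exact: measurable_maxr. Qed.

HB.instance Definition _ Y x :=
  isMeasurableFun.Build _ _ _ _ (floor_at Y x) (@measurable_floor_at Y x).

Lemma rv_integrable_cst x : rv_integrable (cst x : {RV P >-> R}).
Proof. exact: finite_measure_integrable_cst. Qed.

Lemma rv_integrable_floor_at Y x : rv_integrable Y ->
  rv_integrable (floor_at Y x : {RV P >-> R}).
Proof.
move=> Yi; have nYi := integrable_norm Yi.
have nxi := integrable_norm (rv_integrable_cst x).
apply: (le_integrable _ _ _ (integrableD measurableT nYi nxi)) => //.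
  by apply/measurable_EFinP; exact: measurable_floor_at.
move=> w _ /=; rewrite lee_fin /floor_at (ger0_norm (addr_ge0 _ _))//.
by case: (leP (Y w) x) => _; rewrite ?lerDl ?lerDr.
Qed.

Lemma lip_distortion_cap c : 0 <= c -> lip_distortion 1 (cap c).
Proof.
move=> c0; split; first by rewrite /cap min_l.
move=> s s' s0 ss' s1; rewrite /cap mul1r.
by case: (leP s c) => ?; case: (leP s' c) => ?; lra.
Qed.

Lemma survival_cst x t :
  survival (cst x : {RV P >-> R}) t = if t < x then 1 else 0.
Proof.
case: ltP => tx; last by rewrite survival_eq0.
by rewrite survival_eq1//; exact: nearW.
Qed.

Lemma choquet_cst L g x : lip_distortion L g ->
  choquet g (cst x : {RV P >-> R}) = g 1 * x.
Proof.
move=> gL; have xi := rv_integrable_cst x.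
have xE : choquet id (cst x : {RV P >-> R}) = x.
  by apply: EFin_inj; rewrite -expectation_choquet// expectation_cst.
rewrite -[in RHS]xE -(choquetZ _ lip_distortion_id)//.
apply: eq_Rintegral => t _; rewrite /layer !survival_cst.
have [g0 _] := gL.
by case: (t < 0); case: (t < x); rewrite /= ?g0; lra.
Qed.

Lemma survival_floor_at Y x t :
  survival (floor_at Y x : {RV P >-> R}) t = if t < x then 1 else survival Y t.
Proof.
case: ltP => tx.
  by apply: survival_eq1; apply: nearW => w; rewrite /= lt_max tx orbT.
by apply: eq_survival => w; rewrite /= lt_max (le_gtF tx) orbF.
Qed.

Lemma layer_floor_at Y c x t :
  layer id (floor_at Y x : {RV P >-> R}) t
    - (1 - c) * layer id (cst x : {RV P >-> R}) t =
  if t < 0 then (if t < x then 0 else survival Y t - c)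
           else (if t < x then c else survival Y t).
Proof.
rewrite /layer survival_floor_at survival_cst.
by case: (t < 0); case: (t < x) => /=; lra.
Qed.

(** Both terms on the left are expectations, hence integrals of layers of the
    identity distortion. *)
Lemma choquet_floor_at Y c x : rv_integrable Y ->
  choquet id (floor_at Y x : {RV P >-> R}) - (1 - c) * x =
  \int[lebesgue_measure]_t
    (layer id (floor_at Y x : {RV P >-> R}) t
      - (1 - c) * layer id (cst x : {RV P >-> R}) t).
Proof.
move=> Yi.
have Fi := integrable_layer_id (rv_integrable_floor_at x Yi).
have xi := integrable_layer_id (rv_integrable_cst x).
rewrite RintegralB//; last exact: (integrableZl _ (1 - c) xi).
rewrite RintegralZl//; congr (_ - _ * _).
by rewrite [RHS](choquet_cst x lip_distortion_id) mul1r.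
Qed.

Lemma integrable_layer_floor_at Y c x : rv_integrable Y ->
  lebesgue_measure.-integrable setT (EFin \o (fun t =>
    (layer id (floor_at Y x : {RV P >-> R}) t
      - (1 - c) * layer id (cst x : {RV P >-> R}) t))).
Proof.
move=> Yi.
have Fi := integrable_layer_id (rv_integrable_floor_at x Yi).
have xi := integrable_layer_id (rv_integrable_cst x).
exact: (integrableB _ Fi (integrableZl _ (1 - c) xi)).
Qed.

(** Half of the Rockafellar-Uryasev formula
    [choquet (cap c) Y = min_x (E max(Y, x) - (1 - c) x)].
    The layer of the right-hand side is obtained from that of [cap c] by
    replacing [min (S t) c] by [c] below [x] and by [S t] above. *)
Lemma choquet_cap_le Y c x : 0 <= c <= 1 -> rv_integrable Y ->
  choquet (cap c) Y <=
  choquet id (floor_at Y x : {RV P >-> R}) - (1 - c) * x.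
Proof.
move=> /andP[c0 c1] Yi; rewrite choquet_floor_at//; apply: le_Rintegral => //.
- exact: integrable_layer (lip_distortion_cap c0) Yi.
- exact: integrable_layer_floor_at.
move=> t _; rewrite layer_floor_at /layer /cap (min_r c1).
have S1 := survival_le1 Y t.
by case: (t < 0); case: (t < x); case: (leP (survival Y t) c) => ?; lra.
Qed.

(** Right-continuity of the survival function gives the second bound at the
    point [x] itself. *)
Lemma exists_quantile Y c : 0 < c < 1 -> exists x,
  (forall t, t < x -> c <= survival Y t) /\
  (forall t, x <= t -> survival Y t <= c).
Proof.
move=> /andP[c0 c1].
pose A := [set t | survival Y t <= c].
have [a Sa] : exists a, survival Y a < c.
  have := cvgr_lt _ (fine_cvg (cvg_ccdfy0 Y)) _ c0.
  by move=> /(_ _ _)/filter_ex[a Sa]; exists a.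
have [b Sb] : exists b, c < survival Y b.
  have := cvgr_gt _ (fine_cvg (cvg_ccdfNy1 Y)) _ c1.
  by move=> /(_ _ _)/filter_ex[b Sb]; exists b.
have A0 : A !=set0 by exists a; exact: ltW.
have Ab : lbound A b.
  move=> t /= At; rewrite leNgt; apply/negP => /ltW tb.
  by have := lt_le_trans Sb (survival_nonincreasing Y tb); rewrite ltNge At.
have hA : has_inf A by split => //; exists b.
exists (inf A); split => t.
  move=> tA; rewrite leNgt; apply/negP => /ltW At.
  by have := ge_inf hA.2 At; rewrite leNgt tA.
move=> At; apply: le_trans (survival_nonincreasing Y At) _.
have : survival Y s @[s --> (inf A)^'+] --> survival Y (inf A).
  by apply: fine_cvg; rewrite EFin_survival; exact: ccdf_right_continuous.
move=> /cvgr_to_le; apply; near=> s.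
have [e Ae es] : exists2 e, A e & e < s.
  have s0 : 0 < s - inf A by rewrite subr_gt0; near: s; exact: nbhs_right_gt.
  by have [e Ae] := inf_adherent s0 hA; rewrite subrKC; exists e.
exact: le_trans (survival_nonincreasing Y (ltW es)) Ae.
Unshelve. all: by end_near. Qed.

(** The other half of the Rockafellar-Uryasev formula: at an upper
    [c]-quantile the two replacements in [choquet_cap_le] change nothing. *)
Lemma choquet_capE Y c : 0 < c < 1 -> rv_integrable Y ->
  exists x, choquet (cap c) Y =
    choquet id (floor_at Y x : {RV P >-> R}) - (1 - c) * x.
Proof.
move=> c01 Yi; have [x [lo hi]] := exists_quantile Y c01; exists x.
rewrite choquet_floor_at//; apply: eq_Rintegral => t _.
move: c01 => /andP[c0 c1]; rewrite layer_floor_at /layer /cap (min_r (ltW c1)).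
have [tx|xt] := ltP t x.
  by rewrite (min_r (lo _ tx)); case: (t < 0); lra.
by rewrite (min_l (hi _ xt)).
Qed.

Lemma choquet_id_le Y Z1 Z2 : rv_integrable Y -> rv_integrable Z1 ->
  rv_integrable Z2 -> {ae P, forall w, Y w <= Z1 w + Z2 w} ->
  choquet id Y <= choquet id Z1 + choquet id Z2.
Proof.
move=> Yi Z1i Z2i YZ; rewrite -!Rintegral_choquet// -RintegralD//.
by apply: ae_le_Rintegral => //; exact: (integrableD _ Z1i Z2i).
Qed.

(** In the Rockafellar-Uryasev formula, use the sum [x1 + x2] of optimal
    points for [Z1] and [Z2] as a candidate for [Y]; subadditivity reduces to
    [max(z1 + z2, x1 + x2) <= max(z1, x1) + max(z2, x2)]. *)
Lemma choquet_cap_subadditive c Y Z1 Z2 : 0 < c <= 1 ->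
  rv_integrable Y -> rv_integrable Z1 -> rv_integrable Z2 ->
  {ae P, forall w, Y w <= Z1 w + Z2 w} ->
  choquet (cap c) Y <= choquet (cap c) Z1 + choquet (cap c) Z2.
Proof.
move=> /andP[c0]; rewrite le_eqVlt => /predU1P[->|c1] Yi Z1i Z2i YZ.
  (* There is no quantile of level [1], but [cap 1] is the identity. *)
  have cap1 Z : choquet (cap 1) Z = choquet id Z.
    by rewrite /choquet (@eq_layer _ _ _ _ (cap 1) id)// => s /andP[_ s1];
      rewrite /cap min_l.
  by rewrite !cap1 choquet_id_le.
have c01 : 0 < c < 1 by rewrite c0.
have [x1 ->] := choquet_capE c01 Z1i; have [x2 ->] := choquet_capE c01 Z2i.
have c01w : 0 <= c <= 1 by rewrite (ltW c0) (ltW c1).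
have Yx := choquet_cap_le (x1 + x2) c01w Yi.
have : choquet id (floor_at Y (x1 + x2) : {RV P >-> R}) <=
    choquet id (floor_at Z1 x1 : {RV P >-> R})
    + choquet id (floor_at Z2 x2 : {RV P >-> R}).
  apply: choquet_id_le; try exact: rv_integrable_floor_at.
  apply: filterS YZ => w YZw; rewrite /= /floor_at ge_max.
  by rewrite (le_trans YZw) lerD// le_max lexx ?orbT.
by move: Yx; lra.
Qed.

End tail_average.

(** * Piecewise linear interpolation of distortions *)

Section interpolation.
Context {R : realType}.
Implicit Types (g : R -> R) (L s : R) (n i j : nat).

Definition knot n i : R := i%:R / n.+1%:R.

Definition slope n g i : R := n.+1%:R * (g (knot n i.+1) - g (knot n i)).

(** The piecewise linear interpolation of [g] at the knots [i / (n + 1)]: the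
    increment of [cap (knot n _) s] is the part of [[0, s]] that lies between
    two consecutive knots. *)
Definition interp n g s : R :=
  \sum_(0 <= i < n.+1) slope n g i * (cap (knot n i.+1) s - cap (knot n i) s).

Definition midpoint_concave g := forall s s', 0 <= s <= 1 -> 0 <= s' <= 1 ->
  g s + g s' <= 2 * g ((s + s') / 2).

Let n1_gt0 n : 0 < n.+1%:R :> R. Proof. exact: ltr0Sn. Qed.

Lemma knot0 n : knot n 0 = 0. Proof. by rewrite /knot mul0r. Qed.

Lemma knot_last n : knot n n.+1 = 1.
Proof. by rewrite /knot divff// gt_eqF. Qed.

Lemma knotS n i : knot n i.+1 - knot n i = n.+1%:R^-1.
Proof. by rewrite /knot -mulrBl -natrB// subSnn mul1r. Qed.

Lemma knot_ge0 n i : 0 <= knot n i.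
Proof. by rewrite divr_ge0. Qed.

Lemma knot_le n i j : (i <= j)%N -> knot n i <= knot n j.
Proof. by move=> ij; rewrite ler_pM2r ?invr_gt0// ler_nat. Qed.

Lemma knot_le1 n i : (i <= n.+1)%N -> knot n i <= 1.
Proof. by rewrite -(knot_last n); exact: knot_le. Qed.

Lemma slope_bound L g n i : lip_distortion L g -> (i <= n)%N ->
  0 <= slope n g i <= L.
Proof.
move=> [_ gL] lein.
have := gL _ _ (knot_ge0 n i) (knot_le n (leqnSn i))
  (knot_le1 (lein : (i < n.+1)%N)).
rewrite knotS => /andP[g_ge0 gle]; rewrite /slope mulr_ge0//=.
by rewrite mulrC -ler_pdivlMr.
Qed.

(** Every slope of the interpolation lies between [0] and [L]; the parts of
    [[s, s']] between consecutive knots add up to its length. *)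
Lemma lip_distortion_interp L g n : lip_distortion L g ->
  lip_distortion L (interp n g).
Proof.
move=> gL; split.
  rewrite /interp big1// => i _.
  by rewrite /cap !min_l ?knot_ge0// subrr mulr0.
move=> s s' s0 ss' s1; rewrite /interp -sumrB.
have -> : L * (s' - s) = \sum_(0 <= i < n.+1)
    L * ((cap (knot n i.+1) s' - cap (knot n i.+1) s)
       - (cap (knot n i) s' - cap (knot n i) s)).
  rewrite -mulr_sumr telescope_sumr// knot_last knot0 /cap !(min_l s1).
  by rewrite (min_l (le_trans ss' s1)) !min_r// ?(le_trans s0)//; lra.
have term i : (0 <= i < n.+1)%N ->
    0 <= (cap (knot n i.+1) s' - cap (knot n i.+1) s)
       - (cap (knot n i) s' - cap (knot n i) s).
  move=> _; have := knot_le n (leqnSn i); rewrite /cap.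
  by case: (leP s (knot n i)); case: (leP s' (knot n i));
    case: (leP s (knot n i.+1)); case: (leP s' (knot n i.+1)); lra.
apply/andP; split; [rewrite big_nat_cond; apply: sumr_ge0 => i /andP[lin _]|
    apply: ler_sum_nat => i lin];
  have T := term _ lin;
  have /andP[m0 mL] := @slope_bound L g n i gL (proj2 (andP lin));
  rewrite -mulrBr.
- by apply: mulr_ge0 => //; lra.
- rewrite (_ : _ - _ = (cap (knot n i.+1) s' - cap (knot n i.+1) s)
       - (cap (knot n i) s' - cap (knot n i) s)); last by lra.
  by rewrite ler_wpM2r.
Qed.

Lemma interp_knot g n j : g 0 = 0 -> (j <= n.+1)%N ->
  interp n g (knot n j) = g (knot n j).
Proof.
move=> g0 jn; rewrite /interp (big_cat_nat (n := j))//= [X in _ + X]big1_seq.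
  rewrite addr0.
  transitivity (\sum_(0 <= i < j) (g (knot n i.+1) - g (knot n i))).
    apply: eq_big_nat => i /andP[_ ij].
    rewrite /cap !min_r ?knot_le// 1?ltnW// knotS /slope mulrAC divff ?mul1r//.
  by rewrite telescope_sumr// knot0 g0 subr0.
move=> i; rewrite mem_index_iota => /andP[_ /andP[ji _]].
by rewrite /cap !min_l ?knot_le// 1?leqW// subrr mulr0.
Qed.

(** The interpolation agrees with [g] at the knot just below [s], and from
    there on both functions increase by at most [L / (n + 1)]. *)
Lemma interp_dist L g n s : lip_distortion L g -> 0 <= s <= 1 ->
  `|interp n g s - g s| <= L * n.+1%:R^-1.
Proof.
move=> gL /andP[s0 s1]; pose j := Num.truncn (s * n.+1%:R).
have [jlo jhi] : knot n j <= s /\ s < knot n j.+1.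
  have /andP[] := truncn_itv (mulr_ge0 s0 (ltW (n1_gt0 n))).
  by rewrite /knot ler_pdivrMr// ltr_pdivlMr.
have jn : (j <= n.+1)%N.
  rewrite -(ler_nat R); apply: le_trans (_ : s * n.+1%:R <= _).
    by rewrite -ler_pdivrMr.
  by rewrite ler_piMl.
have := knotS n j; have [g0 gl] := gL.
have [_ il] := lip_distortion_interp n gL.
have /andP[A1 A2] := gl _ _ (knot_ge0 n j) jlo s1.
have /andP[B1 B2] := il _ _ (knot_ge0 n j) jlo s1.
rewrite interp_knot// in B1 B2; move=> kS.
have LL : L * (s - knot n j) <= L * n.+1%:R^-1.
  apply: ler_wpM2l; last by rewrite -kS; lra.
  have /andP[] := gl _ _ (lexx 0) ler01 (lexx 1).
  by rewrite subr0 mulr1; lra.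
move: LL; set e := L / _ => LL.
by rewrite ler_norml; apply/andP; split; lra.
Qed.

Lemma abel_sum (m h : nat -> R) n :
  \sum_(0 <= i < n) m i * (h i.+1 - h i) =
  \sum_(0 <= i < n) (m i - m i.+1) * h i.+1 + m n * h n - m 0%N * h 0%N.
Proof.
elim: n => [|n IH]; first by rewrite !big_nil; lra.
by rewrite !big_nat_recr//= IH; lra.
Qed.

(** Summation by parts turns the interpolation into a combination of caps,
    weighted by the drops of its slopes. *)
Lemma interp_mixture g n s : 0 <= s ->
  interp n g s =
  \sum_(0 <= i < n) (slope n g i - slope n g i.+1) * cap (knot n i.+1) s
    + slope n g n * cap (knot n n.+1) s.
Proof.
move=> s0; rewrite /interp big_nat_recr//=.
rewrite (abel_sum (slope n g) (fun i => cap (knot n i) s)).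
by rewrite knot0 /cap (min_r s0) mulr0; lra.
Qed.

Lemma slope_nonincreasing g n i : midpoint_concave g -> (i < n)%N ->
  slope n g i.+1 <= slope n g i.
Proof.
move=> gC ilt; rewrite ler_pM2l//.
have k0 := knot_ge0 n; have k1 := @knot_le1 n.
have := gC (knot n i) (knot n i.+2); rewrite !k0 !k1//; last first.
  exact/ltnW/ltnW.
move=> /(_ isT isT); rewrite (_ : (_ + _) / 2 = knot n i.+1); first by lra.
by have := knotS n i; rewrite -(knotS n i.+1); lra.
Qed.

End interpolation.

(** * Subadditivity for concave distortions *)

Section subadditivity.
Context {d : measure_display} {T : measurableType d} {R : realType}.
Variable P : probability T R.
Implicit Types (Y Z : {RV P >-> R}) (g h : R -> R) (L s t : R).

(** With an inequality instead of [Y = Z1 + Z2], the property also covers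
    monotonicity and equality up to null sets. *)
Definition choquet_subadditive g := forall Y Z1 Z2,
  rv_integrable Y -> rv_integrable Z1 -> rv_integrable Z2 ->
  {ae P, forall w, Y w <= Z1 w + Z2 w} ->
  choquet g Y <= choquet g Z1 + choquet g Z2.

(** The existence of a Lipschitz constant is carried along the induction
    because linearity of the Choquet integral in the distortion needs it. *)
Lemma cap_mixture_subadditive (w c : nat -> R) n :
  (forall i, (i < n)%N -> 0 <= w i) -> (forall i, (i < n)%N -> 0 < c i <= 1) ->
  (exists L, lip_distortion L (fun s => \sum_(0 <= i < n) w i * cap (c i) s)) /\
  choquet_subadditive (fun s => \sum_(0 <= i < n) w i * cap (c i) s).
Proof.
elim: n => [|n IH] w0 c01.
  have l0 : lip_distortion 0 (fun=> 0 : R).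
    by split => // s s' _ _ _; rewrite subrr mul0r lexx.
  have -> : (fun s => \sum_(0 <= i < 0) w i * cap (c i) s) = fun=> 0.
    by apply/funext => s; rewrite big_nil.
  split; first by exists 0.
  move=> Y Z1 Z2 _ _ _ _.
  rewrite /choquet (_ : layer _ = fun _ _ => 0); last first.
    by apply/funext => Z; apply/funext => t; rewrite /layer subrr if_same.
  by rewrite Rintegral_cst// mul0r addr0.
have [[L sL] ss] := IH (fun i ilt => w0 i (ltnW ilt))
  (fun i ilt => c01 i (ltnW ilt)).
have -> : (fun s => \sum_(0 <= i < n.+1) w i * cap (c i) s) =
    fun s => \sum_(0 <= i < n) w i * cap (c i) s + w n * cap (c n) s.
  by apply/funext => s; rewrite big_nat_recr.
have wn := w0 n (ltnSn n); have cn := c01 n (ltnSn n).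
have cL := lip_distortionZ wn (lip_distortion_cap (ltW (proj1 (andP cn)))).
split; first by exists (L + w n * 1); exact: lip_distortionD.
move=> Y Z1 Z2 Yi Z1i Z2i YZ; rewrite !(choquetD sL cL)//.
rewrite !(choquetZ _ (lip_distortion_cap (ltW (proj1 (andP cn)))))//.
have := ss Y Z1 Z2 Yi Z1i Z2i YZ.
have := ler_wpM2l wn (choquet_cap_subadditive cn Yi Z1i Z2i YZ).
lra.
Qed.

(** Midpoint concavity at consecutive knots makes the slopes nonincreasing,
    so that the weights of the caps are nonnegative. *)
Lemma interp_subadditive L g n : lip_distortion L g -> midpoint_concave g ->
  choquet_subadditive (interp n g).
Proof.
move=> gL gC.
(* The last weight is the whole last slope, since the slope drops to 0 at 1. *)
pose w i := if (i < n)%N then slope n g i - slope n g i.+1 else slope n g i.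
have [||_] := @cap_mixture_subadditive w (fun i => knot n i.+1) n.+1.
- move=> i; rewrite ltnS => lein; rewrite /w; case: ifPn => ilt.
    by rewrite subr_ge0 slope_nonincreasing.
  by have /andP[] := slope_bound gL lein.
- move=> i lein; rewrite knot_le1// andbT.
  by rewrite /knot divr_gt0// ltr0Sn.
rewrite /choquet_subadditive /choquet => sub Y Z1 Z2.
have E Z : layer (interp n g) Z =
    layer (fun s => \sum_(0 <= i < n.+1) w i * cap (knot n i.+1) s) Z.
  apply: eq_layer => s /andP[s0 _]; rewrite interp_mixture// big_nat_recr//=.
  congr (_ + _); last by rewrite /w ltnn.
  by apply: eq_big_nat => i /andP[_ ilt]; rewrite /w ilt.
by rewrite !E; exact: sub.
Qed.

Lemma interp_cvg L g s : lip_distortion L g -> 0 <= s <= 1 ->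
  interp n g s @[n --> \oo] --> g s.
Proof.
move=> gL s01; apply/cvgrPdist_le => e e0.
have : L * n.+1%:R^-1 @[n --> \oo] --> L * 0.
  by apply: cvgMr; exact: cvg_harmonic.
rewrite mulr0 => /cvgr_lt /(_ _ e0); apply: filterS => n /ltW; apply: le_trans.
by rewrite distrC; exact: interp_dist.
Qed.

Lemma layer_interp_cvg L g Y t : lip_distortion L g ->
  layer (interp n g) Y t @[n --> \oo] --> layer g Y t.
Proof.
move=> gL; have S01 : 0 <= survival Y t <= 1.
  by rewrite survival_ge0 survival_le1.
rewrite /layer; case: ifPn => _; last exact: interp_cvg gL S01.
apply: cvgB; first exact: interp_cvg gL S01.
by apply: interp_cvg gL _; rewrite ler01 lexx.
Qed.

(** Dominated convergence; since the interpolations share the Lipschitz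
    constant of [g], a multiple of the layer of the identity dominates them
    all. *)
Lemma choquet_interp_cvg L g Y : lip_distortion L g -> rv_integrable Y ->
  choquet (interp n g) Y @[n --> \oo] --> choquet g Y.
Proof.
move=> gL Yi.
have Li := integrableZl measurableT L (integrable_layer_id Yi).
have mL n := measurable_layer Y (lip_distortion_interp n gL).
have cL : {ae lebesgue_measure, forall t, setT t ->
    (layer (interp n g) Y t)%:E @[n --> \oo] --> (layer g Y t)%:E}.
  by apply: nearW => t _; apply: cvg_EFin; [exact: nearW|
    exact: layer_interp_cvg gL].
have bL : {ae lebesgue_measure, forall t n, setT t ->
    (`|(layer (interp n g) Y t)%:E| <= `|L%:E * (layer id Y t)%:E|)%E}.
  apply: nearW => t n _; rewrite -EFinM !abse_EFin lee_fin normrM.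
  apply: le_trans (normr_layer_le Y t (lip_distortion_interp n gL)) _.
  by rewrite ler_wpM2r// ler_norm.
have mLE n : measurable_fun setT (fun t => (layer (interp n g) Y t)%:E).
  by apply/measurable_EFinP; exact: mL.
have mE : measurable_fun setT (fun t => (layer g Y t)%:E).
  by apply/measurable_EFinP; exact: measurable_layer gL.
have [_ _] := @dominated_convergence _ _ R (@lebesgue_measure R) setT
  measurableT _ _ _ mLE mE cL (integrable_abse Li) bL.
rewrite -(@fineK _ (\int[_]_(_ in _) (layer g Y _)%:E)%E); last first.
  exact: integrable_fin_num (integrable_layer gL Yi).
by move=> /fine_cvg.
Qed.

(** A concave distortion is a limit of mixtures of caps, and subadditivity
    survives mixtures and limits. *)
Theorem concave_subadditive L g : lip_distortion L g -> midpoint_concave g ->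
  choquet_subadditive g.
Proof.
move=> gL gC Y Z1 Z2 Yi Z1i Z2i YZ.
apply: ler_cvg_to (choquet_interp_cvg gL Yi)
  (cvgD (choquet_interp_cvg gL Z1i) (choquet_interp_cvg gL Z2i)) _.
by apply: nearW => n; exact: interp_subadditive gL gC _ _ _ Yi Z1i Z2i YZ.
Qed.

End subadditivity.

(** * Optimal layering of a loss between two distortions *)

Section optimal_layer.
Context {d : measure_display} {T : measurableType d} {R : realType}.
Variable P : probability T R.
Implicit Types (X Y Z : {RV P >-> R}) (g h K : R -> R) (L s t : R).

Lemma eq_choquet g Y Z : Y =1 Z -> choquet g Y = choquet g Z.
Proof.
move=> YZ; apply: eq_Rintegral => t _.
by rewrite /layer (@eq_survival _ _ _ _ Y Z)// => w; rewrite YZ.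
Qed.

Lemma lip_distortion_min L1 L2 K1 K2 :
  lip_distortion L1 K1 -> lip_distortion L2 K2 ->
  lip_distortion (L1 + L2) (fun s => Num.min (K1 s) (K2 s)).
Proof.
move=> [K10 K1L] [K20 K2L]; split; first by rewrite K10 K20 minxx.
move=> s s' s0 ss' s1; have /andP[? ?] := K1L _ _ s0 ss' s1.
have /andP[? ?] := K2L _ _ s0 ss' s1; rewrite mulrDl.
by case: (leP (K1 s) (K2 s)); case: (leP (K1 s') (K2 s')); lra.
Qed.

Lemma midpoint_concave_min K1 K2 :
  midpoint_concave K1 -> midpoint_concave K2 ->
  midpoint_concave (fun s => Num.min (K1 s) (K2 s)).
Proof.
move=> K1C K2C s s' s01 s01'; have := K1C _ _ s01 s01'.
have := K2C _ _ s01 s01'.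
by case: (leP (K1 s) (K2 s)); case: (leP (K1 s') (K2 s'));
  case: (leP (K1 ((s + s') / 2)) (K2 ((s + s') / 2))); lra.
Qed.

(** The lower bound on all allocations: lower both distortions to their
    minimum, which is again concave, and apply subadditivity. *)
Lemma choquet_min_le L1 L2 K1 K2 X Z1 Z2 :
  lip_distortion L1 K1 -> lip_distortion L2 K2 ->
  midpoint_concave K1 -> midpoint_concave K2 -> K1 1 = K2 1 ->
  rv_integrable X -> rv_integrable Z1 -> rv_integrable Z2 ->
  {ae P, forall w, X w <= Z1 w + Z2 w} ->
  choquet (fun s => Num.min (K1 s) (K2 s)) X <= choquet K1 Z1 + choquet K2 Z2.
Proof.
move=> K1L K2L K1C K2C K11 Xi Z1i Z2i XZ.
have mL := lip_distortion_min K1L K2L.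
have := concave_subadditive mL (midpoint_concave_min K1C K2C) Xi Z1i Z2i XZ.
move=> /le_trans; apply; apply: lerD; (apply: le_choquet => //;
  [exact: mL|by [exact: K1L|exact: K2L]|]) => t;
  rewrite /layer -K11 minxx; case: ifPn => _;
  by rewrite ?lerB// ge_min lexx ?orbT.
Qed.

Lemma rv_integrable_deductible (D : \bar R) X : (0 <= D)%E -> rv_integrable X ->
  rv_integrable (deductible D \o X : {RV P >-> R}).
Proof.
move=> D0 Xi; apply: le_integrable Xi => //.
  by apply/measurable_EFinP; exact: measurable_funPT.
move=> w _; rewrite /= lee_fin.
case: D D0 => [r| |] //= r0; rewrite ?normr0//.
rewrite lee_fin in r0; case: (leP (X w - r) 0) => Xr; first by rewrite normr0.
by have := ler_norm (X w); rewrite (ger0_norm (ltW Xr)); lra.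
Qed.

Lemma rv_integrable_retained (D : \bar R) X : (0 <= D)%E -> rv_integrable X ->
  rv_integrable (X \- (deductible D \o X) : {RV P >-> R}).
Proof.
move=> D0 Xi; exact: (integrableB _ Xi (rv_integrable_deductible D0 Xi)).
Qed.

(** The retained risk is [min(X, r)]. *)
Lemma survival_retained (r : R) X t :
  survival (X \- (deductible r%:E \o X) : {RV P >-> R}) t =
  if t < r then survival X t else 0.
Proof.
case: ltP => tr; [apply: eq_survival => w /= | apply: survival_eq0 => w /=];
  case: (leP (X w - r) 0) => Xr; rewrite ?subr0//; last by lra.
- by rewrite subKr tr; apply/esym; lra.
- by rewrite (le_trans _ tr)//; lra.
Qed.

Lemma ae_neq (r : R) : {ae @lebesgue_measure R, forall t, t != r}.
Proof.
exists [set r]; split => //; first exact: lebesgue_measure_set1.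
by move=> t /= /negP; rewrite negbK => /eqP.
Qed.

(** The set [B] says which of the two distortions is the cheaper one, [K1] on
    [B] and [K2] off [B].  As [B] is closed downwards and the survival
    function decreases, the thresholds [t >= 0] with [survival X t] in [B]
    form an upper half-line; [D] is its left end, [+oo] if there are none.
    Then the layers above [D] are priced by [K1], those below by [K2], and the
    total is the lower bound of [choquet_min_le]. *)
Theorem exists_optimal_deductible L1 L2 K1 K2 (B : set R) X :
  lip_distortion L1 K1 -> lip_distortion L2 K2 ->
  midpoint_concave K1 -> midpoint_concave K2 -> K1 1 = K2 1 ->
  (forall s s', 0 <= s -> s <= s' -> s' <= 1 -> B s' -> B s) ->
  (forall s, 0 <= s <= 1 -> B s -> K1 s <= K2 s) ->
  (forall s, 0 <= s <= 1 -> ~ B s -> K2 s <= K1 s) ->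
  {ae P, forall w, 0 <= X w} -> rv_integrable X ->
  exists D : \bar R, (0 <= D)%E /\
    forall Z1 Z2, rv_integrable Z1 -> rv_integrable Z2 ->
    {ae P, forall w, Z1 w + Z2 w = X w} ->
    choquet K1 (deductible D \o X : {RV P >-> R})
      + choquet K2 (X \- (deductible D \o X) : {RV P >-> R})
    <= choquet K1 Z1 + choquet K2 Z2.
Proof.
move=> K1L K2L K1C K2C K11 Bdown Ble Bgt X0 Xi.
pose g s := Num.min (K1 s) (K2 s); have gL := lip_distortion_min K1L K2L.
have [K10 _] := K1L; have [K20 _] := K2L.
have S01 t : 0 <= survival X t <= 1 by rewrite survival_ge0 survival_le1.
have S_lt0 t : t < 0 -> survival X t = 1.
  by move=> t0; apply: survival_eq1; apply: filterS X0 => w; exact: lt_le_trans.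
suff [D [D0 DX]] : exists D : \bar R, (0 <= D)%E /\
    choquet K1 (deductible D \o X : {RV P >-> R})
      + choquet K2 (X \- (deductible D \o X) : {RV P >-> R}) <= choquet g X.
  exists D; split=> // Z1 Z2 Z1i Z2i ZX; apply: le_trans DX _.
  apply: (choquet_min_le K1L K2L K1C K2C K11 Xi Z1i Z2i).
  by apply: filterS ZX => w ->.
pose A := [set t | 0 <= t /\ B (survival X t)].
have [A0|/nonemptyPn A0] := pselect (A !=set0); last first.
  exists +oo%E; split; first exact: leey.
  rewrite (@eq_choquet _ _ (cst 0))// (choquet_cst _ _ K1L) mulr0 add0r.
  rewrite (@eq_choquet _ _ X) => [|w /=]; last by rewrite subr0.
  apply: (le_choquet K2L gL Xi Xi) => t; rewrite /layer /g -K11 minxx.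
  have [t0|t0] := ltP t 0; first by rewrite S_lt0// -K11 minxx.
  rewrite le_min lexx andbT Bgt// => BS.
  by have : A t by []; rewrite A0.
have Alb : lbound A 0 by move=> t [].
have hA : has_inf A by split => //; exists 0.
pose r := inf A; have r0 : 0 <= r by exact: lb_le_inf.
exists r%:E; split => //.
have ci := rv_integrable_cst P (- r); have fi := rv_integrable_floor_at r Xi.
have di := rv_integrable_deductible (r0 : (0 <= r%:E)%E) Xi.
have si := rv_integrable_retained (r0 : (0 <= r%:E)%E) Xi.
(* Writing the claim as [max(X, r) - r] avoids any translation of the
   integration variable: subadditivity splits off the constant. *)
have : {ae P, forall w, (deductible r%:E \o X : {RV P >-> R}) w <=
    (floor_at X r : {RV P >-> R}) w + (cst (- r) : {RV P >-> R}) w}.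
  apply: nearW => w /=; rewrite /floor_at.
  by case: (leP (X w - r) 0); case: (leP (X w) r); lra.
move=> /(concave_subadditive K1L K1C di fi ci).
rewrite (choquet_cst _ _ K1L) mulrN -(choquet_cst P r K1L) => ded_le.
suff : choquet K1 (floor_at X r : {RV P >-> R})
    - choquet K1 (cst r : {RV P >-> R})
    + choquet K2 (X \- (deductible r%:E \o X) : {RV P >-> R}) <= choquet g X.
  by move: ded_le; lra.
have fLi := integrable_layer K1L fi.
have cLi := integrable_layer K1L (rv_integrable_cst P r).
have sLi := integrable_layer K2L si.
rewrite -RintegralB// -RintegralD//; last exact: (integrableB _ fLi cLi).
apply: ae_le_Rintegral.
- exact: (integrableD _ (integrableB _ fLi cLi) sLi).
- exact: integrable_layer gL Xi.
apply: (@filterS _ _ (ae_filter_ringOfSetsType (@lebesgue_measure R))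
  _ _ _ (ae_neq r)) => t tr.
rewrite /layer survival_floor_at survival_cst survival_retained /g.
have [t0|t0] := ltP t 0.
  by rewrite (lt_le_trans t0 r0) S_lt0// -K11 minxx; lra.
have [tlt|rt] := ltP t r.
  have nB : ~ B (survival X t).
    by move=> BS; have := @ge_inf _ _ hA.2 t (conj t0 BS); rewrite leNgt tlt.
  by rewrite min_r ?Bgt//; lra.
have {}rt : r < t by rewrite lt_neqAle eq_sym tr.
have BS : B (survival X t).
  have tr0 : 0 < t - r by rewrite subr_gt0.
  have [e [e0 Be]] := inf_adherent tr0 hA; rewrite subrKC => et.
  apply: Bdown Be; rewrite ?survival_ge0 ?survival_le1//.
  exact: survival_nonincreasing (ltW et).
by rewrite min_l ?Ble// K10 K20; lra.
Qed.

End optimal_layer.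

(** * Dual power distortions and the two preferences *)

Section dual_power.
Context {R : realType}.
Implicit Types (a p q s u v x y k : R).

Lemma powR_convex p x y k : 1 <= p -> 0 <= x -> 0 <= y -> 0 <= k <= 1 ->
  (k * x + (1 - k) * y) `^ p <= k * x `^ p + (1 - k) * y `^ p.
Proof.
move=> p1 x0 y0 /andP[k0 k1].
by apply: (convex_powR p1 (Itv01 k0 k1));
  rewrite inE /= in_itv/= andbT.
Qed.

(** By convexity the slope of the power function between [u] and [v] is at most
    its slope between [u] and [2], and [2 - u >= 1]. *)
Lemma powR_lipschitz p u v : 1 <= p -> 0 <= u -> u <= v -> v <= 1 ->
  0 <= v `^ p - u `^ p <= 2 `^ p * (v - u).
Proof.
move=> p1 u0 uv v1; have p0 : 0 <= p by lra.
have v0 := le_trans u0 uv.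
rewrite subr_ge0 ge0_ler_powR//=.
(* [v] is the convex combination of [u] and [2] with weights [k], [1 - k]. *)
pose k := (2 - v) / (2 - u).
have k01 : 0 <= k <= 1.
  by rewrite divr_ge0 ?ler_pdivrMr; lra.
have vE : v = k * u + (1 - k) * 2.
  by rewrite /k; field; apply/eqP; lra.
have kle : 1 - k <= v - u.
  rewrite (_ : 1 - k = (v - u) / (2 - u)).
    by rewrite ler_pdivrMr; nra.
  by rewrite /k; field; apply/eqP; lra.
have := @powR_convex p u 2 k p1 u0 (ler0n _ 2) k01; rewrite -vE.
have := powR_ge0 2 p; have := powR_ge0 u p; move: (2 `^ p) (u `^ p) => A B.
by move/andP: k01 => [? ?]; nra.
Qed.

Lemma dual_power0 a : dual_power a 0 = 0.
Proof. by rewrite /dual_power subr0 powR1 subrr. Qed.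

Lemma dual_power1 a : 0 < a -> dual_power a 1 = 1.
Proof. by move=> a0; rewrite /dual_power subrr powR0 ?subr0// gt_eqF. Qed.

Lemma lip_distortion_dual_power a : 1 <= a ->
  lip_distortion (2 `^ a) (dual_power a).
Proof.
move=> a1; split; first exact: dual_power0.
move=> s s' s0 ss' s1; rewrite /dual_power.
have := @powR_lipschitz a (1 - s') (1 - s) a1.
rewrite !subr_ge0 lerB// => /(_ s1 isT); rewrite gerBl => /(_ s0).
rewrite (_ : 1 - s - (1 - s') = s' - s); last by lra.
by move=> /andP[? ?]; apply/andP; split; lra.
Qed.

Lemma midpoint_concave_dual_power a : 1 <= a -> midpoint_concave (dual_power a).
Proof.
move=> a1 s s' /andP[s0 s1] /andP[s0' s1']; rewrite /dual_power.
have := @powR_convex a (1 - s) (1 - s') 2^-1 a1.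
rewrite !subr_ge0 => /(_ s1 s1').
rewrite (_ : 2^-1 * (1 - s) + (1 - 2^-1) * (1 - s') = 1 - (s + s') / 2);
  last by lra.
have h : 0 <= (2^-1 : R) <= 1 by apply/andP; split; lra.
by move=> /(_ h); lra.
Qed.

Lemma le_dual_power a s : 1 <= a -> 0 <= s <= 1 -> s <= dual_power a s.
Proof.
move=> a1 /andP[s0 s1]; rewrite /dual_power.
have := @powR_convex a 1 0 (1 - s) a1 ler01 (lexx 0).
rewrite mulr1 mulr0 addr0 powR1 powR0 ?mulr0 ?addr0 ?mulr1;
  last by apply/eqP; lra.
have h : 0 <= 1 - s <= 1 by apply/andP; split; lra.
by move=> /(_ h); lra.
Qed.

(** The distortion charged to the buyer once the premium term of the weighted
    objective has been shifted to that agent. *)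
Definition mixed_dual_power k a s := k * dual_power a s + (1 - k) * s.

(** Put [u = 1 - x] and divide the inequality by [u]: with
    [v = u ^ (p - 1)] it reads [1 - k <= f v], where
    [f v = v - k v ^ ((q - 1) / (p - 1))].  The exponent is at least [1], so
    [f] is concave, and [f 1 = 1 - k]; hence the solutions in [[0, 1]] form an
    interval that ends at [1]. *)
Lemma mixed_dual_power_crossing k p q s s' : 0 <= k -> 1 < p -> p < q ->
  0 <= s -> s <= s' -> s' < 1 ->
  dual_power p s' <= mixed_dual_power k q s' ->
  dual_power p s <= mixed_dual_power k q s.
Proof.
move=> k0 p1 pq s0 ss' s1'.
pose f v := v - k * v `^ ((q - 1) / (p - 1)).
have crossE x : x < 1 -> (dual_power p x <= mixed_dual_power k q x) =
    (1 - k <= f ((1 - x) `^ (p - 1))).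
  move=> x1; have u0 : 0 < 1 - x by lra.
  rewrite /f -powRrM [(p - 1) * _]mulrC divfK; last by apply/eqP; lra.
  rewrite /mixed_dual_power /dual_power.
  have E r : (1 - x) `^ r = (1 - x) * (1 - x) `^ (r - 1).
    rewrite -{2}(powRr1 (ltW u0)) -powRD; first by rewrite subrKC.
    by apply/implyP => _; rewrite gt_eqF.
  rewrite (E p) (E q) -(ler_pM2l u0 (1 - k)) -[LHS]subr_ge0 -[RHS]subr_ge0.
  by congr (0 <= _); ring.
rewrite !crossE; [|lra|lra].
set v' := (1 - s') `^ _; set v := (1 - s) `^ _ => fv'.
have v'0 : 0 < v' by apply: powR_gt0; lra.
have vv : v' <= v by apply: ge0_ler_powR; rewrite ?nnegrE; lra.
have v1 : v <= 1.
  have <- : 1 `^ (p - 1) = 1 :> R by rewrite powR1.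
  by apply: ge0_ler_powR; rewrite ?nnegrE; lra.
have [v'1|v'1] := ltP v' 1; last first.
  by have -> : v = v' by apply/eqP; rewrite eq_le vv (le_trans v1).
(* [v] is the convex combination of [v'] and [1] with weights [c], [1 - c]. *)
pose c := (1 - v) / (1 - v').
have c01 : 0 <= c <= 1 by rewrite divr_ge0 ?ler_pdivrMr; lra.
have vE : v = c * v' + (1 - c) * 1 by rewrite /c; field; apply/eqP; lra.
have e1 : 1 <= (q - 1) / (p - 1) by rewrite ler_pdivlMr; lra.
have := powR_convex e1 (ltW v'0) ler01 c01; rewrite -vE powR1.
move: fv'; rewrite /f; move: (v' `^ _) (v `^ _) => A B hA hB.
by move/andP: c01 => [? ?]; rewrite {1}vE; nra.
Qed.

End dual_power.

Section preferences.
Context {d : measure_display} {T : measurableType d} {R : realType}.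
Variable P : probability T R.
Implicit Types (X Y Z : {RV P >-> R}) (g : R -> R).

Lemma rv_integrable_expectation Y : 'E_P[Y]%E \is a fin_num -> rv_integrable Y.
Proof.
rewrite unlock integralE fin_numB => /andP[Yp Yn]; apply/integrableP.
have mY : measurable_fun setT (EFin \o Y).
  by apply/measurable_EFinP; exact: measurable_funPT.
split => //; rewrite -[fun x => _]/(abse \o (EFin \o Y)) fune_abse.
rewrite ge0_integralD//; last 2 first.
- exact: measurable_funepos.
- exact: measurable_funeneg.
by rewrite lte_add_pinfty// ltey_eq ?Yp ?Yn.
Qed.

Lemma fin_num_pMl (c : R) (x : \bar R) : 0 < c ->
  (c%:E * x \is a fin_num)%E = (x \is a fin_num).
Proof.
by move=> c0; case: x => [r| |] //; rewrite ?gt0_muley ?gt0_muleNy ?lte_fin.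
Qed.

(** Finiteness of the difference forces a finite expectation, hence
    integrability; conversely Lipschitz distortions have a finite risk measure
    at every integrable variable. *)
Lemma pref_fin_num_iff (a b L : R) g Y : 0 < a -> 0 < b ->
  lip_distortion L g -> g 1 = 1 ->
  (a%:E * distortion_risk g Y - b%:E * 'E_P[Y] \is a fin_num)%E <->
  rv_integrable Y.
Proof.
move=> a0 b0 gL g1; split.
  rewrite fin_numB !fin_num_pMl// => /andP[_]; exact: rv_integrable_expectation.
move=> Yi; rewrite (distortion_risk_choquet gL)// expectation_choquet//.
Qed.

(** Since [g] dominates the identity, the finite risk bounds the expectation of
    the positive part. *)
Lemma rv_integrable_distortion_risk L g X : lip_distortion L g ->
  (forall s, 0 <= s <= 1 -> s <= g s) -> {ae P, forall w, 0 <= X w} ->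
  distortion_risk g X \is a fin_num -> rv_integrable X.
Proof.
move=> gL g_ge X0; rewrite /distortion_risk fin_numD => /andP[_ gfin].
have mX : measurable_fun setT (EFin \o X).
  by apply/measurable_EFinP; exact: measurable_funPT.
apply/integrableP; split => //.
pose Xp : {RV P >-> R} := X^\+.
have -> : (\int[P]_w `|(EFin \o X) w| = 'E_P[Xp])%E.
  rewrite unlock; apply: ae_eq_integral => //.
  - exact: measurableT_comp.
  - by apply/measurable_EFinP; exact: measurable_funPT.
  - apply: filterS X0 => w Xw _ /=.
    by rewrite /Xp /= /funrpos max_l// ger0_norm.
rewrite ge0_expectation_ccdf; last by move=> w; exact: funrpos_ge0.
apply: le_lt_trans (_ : (\int[lebesgue_measure]_(t in `[0%R, +oo[)
    (g (survival X t))%:E < +oo)%E); last by rewrite ltey_eq gfin.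
apply: ge0_le_integral => //=.
- by apply: measurable_funTS; exact: ccdf_measurable.
- by apply/measurable_EFinP/measurable_funTS;
    exact: measurable_comp_survival gL.
move=> t; rewrite in_itv/= andbT => t0; rewrite -EFin_survival lee_fin.
rewrite (@eq_survival _ _ _ _ Xp X) => [|w]; last first.
  by rewrite /Xp /= /funrpos lt_max (le_gtF t0) orbF.
by apply: g_ge; rewrite survival_ge0 survival_le1.
Qed.

Lemma choquet_id_add X Z1 Z2 : rv_integrable X -> rv_integrable Z1 ->
  rv_integrable Z2 -> {ae P, forall w, Z1 w + Z2 w = X w} ->
  choquet id Z1 + choquet id Z2 = choquet id X.
Proof.
move=> Xi Z1i Z2i ZX; rewrite -!Rintegral_choquet// -RintegralD//.
by apply: ae_eq_Rintegral => //; exact: (integrableD _ Z1i Z2i).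
Qed.

End preferences.

Section weights.
Context {R : realType}.
Implicit Types theta b a r m : R.

(** The weights [theta] and [theta - b] make the weighted sum of the two
    preferences invariant under the transfer of a constant between the agents.
    On an allocation, [m1 + m2] is the mean of the total loss, so that only the
    first term on the right depends on how the loss is shared. *)
Lemma weighted_pref theta b r1 r2 m1 m2 : theta != 0 -> 1 + b != 0 ->
  theta * (1 + b)
    * (r1 + ((theta - b) / (theta * (1 + b)) * r2
             + (1 - (theta - b) / (theta * (1 + b))) * m2))
    - theta * (1 + theta) * (m1 + m2) =
  theta * ((1 + b) * r1 - (1 + theta) * m1)
    + (theta - b) * (r2 - (1 + theta) * m2).
Proof. by move=> ? ?; field; apply/andP. Qed.

Lemma weighted_le_eq a b (u1 u2 v1 v2 : R) : 0 < a -> 0 < b ->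
  u1 <= v1 -> u2 <= v2 -> a * v1 + b * v2 <= a * u1 + b * u2 ->
  u1 = v1 /\ u2 = v2.
Proof.
move=> a0 b0 uv1 uv2 le_uv.
have /(ler_wpM2l (ltW a0)) auv1 := uv1; have /(ler_wpM2l (ltW b0)) buv2 := uv2.
by split; apply/eqP; rewrite eq_le ?uv1 ?uv2/=;
  [rewrite -(ler_pM2l a0)|rewrite -(ler_pM2l b0)]; lra.
Qed.

End weights.

Unset Implicit Arguments.

Theorem corollary3 (d : measure_display) (T : measurableType d) (R : realType)
    (P : probability T R) (X : {RV P >-> R}) (b1 theta d1 d2 : R)
    (X_ge0 : {ae P, forall w, 0 <= X w})
    (b1_gt0 : 0 < b1) (b1_lt_theta : b1 < theta)
    (d1_gt1 : 1 < d1) (d1_lt_d2 : d1 < d2)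
    (HX_fin : distortion_risk (dual_power d2) X \is a fin_num) :
  deductible_optimal (insurer_pref b1 theta (dual_power d1))
    (buyer_pref theta (dual_power d2)) X.
Proof.
have d1w := ltW d1_gt1; have d2w := le_trans d1w (ltW d1_lt_d2).
have d1_1 := dual_power1 (lt_le_trans ltr01 d1w).
have d2_1 := dual_power1 (lt_le_trans ltr01 d2w).
have g1L := lip_distortion_dual_power d1w.
have g2L := lip_distortion_dual_power d2w.
have theta_gt0 : 0 < theta by lra.
have theta_b1 : 0 < theta - b1 by lra.
have Xi : rv_integrable X.
  by apply: rv_integrable_distortion_risk g2L _ X_ge0 HX_fin => s;
    exact: le_dual_power.
pose k := (theta - b1) / (theta * (1 + b1)).
have den : 0 < theta * (1 + b1) by nra.
have k0 : 0 <= k by rewrite divr_ge0; lra.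
have k1 : k <= 1 by rewrite ler_pdivrMr; nra.
have k1' : 0 <= 1 - k by lra.
pose K2 := mixed_dual_power k d2.
have kgL := lip_distortionZ k0 g2L.
have kiL := lip_distortionZ k1' (@lip_distortion_id R).
have K2L : lip_distortion (k * 2 `^ d2 + (1 - k) * 1) K2.
  exact: lip_distortionD kgL kiL.
have K2C : midpoint_concave K2.
  move=> s s' s01 s01'; have := midpoint_concave_dual_power d2w s01 s01'.
  by rewrite /K2 /mixed_dual_power; nra.
have K21 : K2 1 = 1 by rewrite /K2 /mixed_dual_power d2_1; lra.
have b1p : 0 < 1 + b1 by lra.
have tp : 0 < 1 + theta by lra.
have V1P (Z : {RV P >-> R}) :
    insurer_pref b1 theta (dual_power d1) Z \is a fin_num <-> rv_integrable Z.
  exact: pref_fin_num_iff b1p tp g1L d1_1.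
have V2P (Z : {RV P >-> R}) :
    buyer_pref theta (dual_power d2) Z \is a fin_num <-> rv_integrable Z.
  by have := pref_fin_num_iff Z ltr01 tp g2L d2_1; rewrite mul1e.
have V1E (Z : {RV P >-> R}) : rv_integrable Z ->
    insurer_pref b1 theta (dual_power d1) Z =
    ((1 + b1) * choquet (dual_power d1) Z - (1 + theta) * choquet id Z)%:E.
  move=> Zi; rewrite /insurer_pref (distortion_risk_choquet g1L)//.
  by rewrite expectation_choquet.
have V2E (Z : {RV P >-> R}) : rv_integrable Z ->
    buyer_pref theta (dual_power d2) Z =
    (choquet (dual_power d2) Z - (1 + theta) * choquet id Z)%:E.
  move=> Zi; rewrite /buyer_pref (distortion_risk_choquet g2L)//.
  by rewrite expectation_choquet.
have optimal (Y1 Y2 : {RV P >-> R}) : rv_integrable Y1 -> rv_integrable Y2 ->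
    {ae P, forall w, Y1 w + Y2 w = X w} ->
    (forall Z1 Z2 : {RV P >-> R}, rv_integrable Z1 -> rv_integrable Z2 ->
      {ae P, forall w, Z1 w + Z2 w = X w} ->
      choquet (dual_power d1) Y1 + choquet K2 Y2
      <= choquet (dual_power d1) Z1 + choquet K2 Z2) ->
    pareto_optimal (insurer_pref b1 theta (dual_power d1))
      (buyer_pref theta (dual_power d2)) X Y1 Y2.
  move=> Y1i Y2i YX Yopt.
  split; first by split => //; [exact/V1P|exact/V2P].
  move=> Z1 Z2 [ZX /V1P Z1i /V2P Z2i].
  rewrite !V1E// !V2E// !lee_fin => V1le V2le.
  have := Yopt Z1 Z2 Z1i Z2i ZX.
  rewrite /K2 /mixed_dual_power !(choquetD kgL kiL)// !(choquetZ _ g2L)//.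
  rewrite !(choquetZ _ (@lip_distortion_id R))//.
  rewrite -(ler_pM2l den) -(lerD2r (- (theta * (1 + theta) * choquet id X))).
  rewrite -{1}(choquet_id_add Xi Y1i Y2i YX) -(choquet_id_add Xi Z1i Z2i ZX).
  rewrite !weighted_pref ?gt_eqF// => Wle.
  have [E1 E2] := weighted_le_eq theta_gt0 theta_b1 V1le V2le Wle.
  split; [exact: (congr1 EFin E1)|exact: (congr1 EFin E2)].
(* At [s = 1] both distortions equal 1; leaving this point out keeps the set
   closed downwards. *)
pose B := [set s | s < 1 /\ dual_power d1 s <= K2 s].
have [D [D0 Dopt]] : exists D : \bar R, (0 <= D)%E /\
    forall Z1 Z2 : {RV P >-> R}, rv_integrable Z1 -> rv_integrable Z2 ->
    {ae P, forall w, Z1 w + Z2 w = X w} ->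
    choquet (dual_power d1) (deductible D \o X : {RV P >-> R})
      + choquet K2 (X \- (deductible D \o X) : {RV P >-> R})
    <= choquet (dual_power d1) Z1 + choquet K2 Z2.
  apply: (exists_optimal_deductible (B := B) g1L K2L _ K2C _ _ _ _ X_ge0 Xi).
  - exact: midpoint_concave_dual_power.
  - by rewrite d1_1 K21.
  - move=> s s' s0 ss' _ [s1 Ks]; split; first exact: le_lt_trans s1.
    exact: mixed_dual_power_crossing Ks.
  - by move=> s _ [].
  - move=> s /andP[s0]; rewrite le_eqVlt => /predU1P[->|s1] nB.
      by rewrite d1_1 K21.
    by rewrite leNgt; apply/negP => /ltW ?; apply: nB.
exists D; split => //.
apply: optimal Dopt; first exact: rv_integrable_deductible.
  exact: rv_integrable_retained.
by apply: nearW => w; rewrite /= subrKC.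
Qed.
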